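(* Let $R$ be a Noetherian ring and $E\subseteq G\simeq R^e$ a finitely generated torsionfree $R$-module having rank $e>0$. Then, up to isomorphism, $F_0(G/E)\subseteq F_e(E)$; that is, $F_0(G/E)$ is isomorphic as an $R$-module to an ideal of $R$ contained in $F_e(E)$. Moreover, if $E$ is an ideal module with $\operatorname{proj\,dim}E=1$, then $$F_0(G/E)=F_e(E).$$
   Context: A finitely generated module $E$ over a Noetherian ring $R$ with total ring of fractions $Q$ has rank $e$ if $E\otimes_RQ\simeq Q^e$. $F_i(M)$ is the $i$-th Fitting ideal: if $R^m\xrightarrow{\varphi}R^n\to M\to 0$ is a finite presentation, $F_i(M)$ is the ideal generated by the $(n-i)\times(n-i)$ minors of $\varphi$. A torsionfree module $E\subseteq G\simeq R^e$ is an ideal module if $\operatorname{grade}G/E\ge 2$, where the grade of a finitely generated module is the grade of its annihilator. *)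

(* Defs.v *)
From HB Require Import structures.
From mathcomp Require Import all_boot all_algebra.
From mathcomp Require Import boolp classical_sets functions.

Set Implicit Arguments.
Unset Strict Implicit.
Unset Printing Implicit Defensive.

Import GRing.Theory.
Local Open Scope ring_scope.
Local Open Scope quotient_scope.
Local Open Scope classical_set_scope.

(* Rings are commutative with 1; the zero ring is allowed (comPzRingType).    *)

Section Submodules.
Variables (R : pzRingType) (G : lmodType R) (E : submodClosed G).

Record submod : predArgType := Submod { submod_val : G; _ : submod_val \in E }.

HB.instance Definition _ := [isSub for submod_val].
HB.instance Definition _ := [Choice of submod by <:].
HB.instance Definition _ := [SubChoice_isSubLmodule of submod by <:].

(* Quotient.quot takes a zmodClosed predicate, which a submodClosed one is    *)
(* not canonically.                                                           *)
Definition submod_pred : {pred G} := E.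

Fact submod_pred_zmod_closed : zmod_closed submod_pred.
Proof. exact: GRing.submod_closedB (submodClosedP E). Qed.

HB.instance Definition _ :=
  GRing.isZmodClosed.Build G submod_pred submod_pred_zmod_closed.

Definition quotmod := Quotient.quot submod_pred.

HB.instance Definition _ := GRing.Zmodule.on quotmod.

Definition quotmod_pi (x : G) : quotmod := \pi_(Quotient.quot submod_pred) x.

Definition quotmod_repr (u : quotmod) : G := repr u.

Definition quotmod_scale (a : R) (u : quotmod) : quotmod :=
  quotmod_pi (a *: quotmod_repr u).

Lemma quotmod_piK : cancel quotmod_repr quotmod_pi.
Proof. exact: reprK. Qed.

Lemma quotmod_eqE (x y : G) : quotmod_pi x = quotmod_pi y <-> x - y \in E.
Proof.
have -> : (x - y \in E) = (quotmod_pi x == quotmod_pi y).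
  exact: (@Quotient.idealrBE _ submod_pred).
by split=> [/eqP|/eqP].
Qed.

Lemma quotmod_piD : {morph quotmod_pi : x y / x + y}.
Proof. by move=> x y; rewrite /quotmod_pi !piE. Qed.

Lemma quotmod_piZ a x : quotmod_scale a (quotmod_pi x) = quotmod_pi (a *: x).
Proof.
apply/quotmod_eqE; rewrite -scalerBr rpredZ//.
exact/quotmod_eqE/quotmod_piK.
Qed.

Lemma quotmod_scaleA a b u :
  quotmod_scale a (quotmod_scale b u) = quotmod_scale (a * b) u.
Proof. by rewrite -[u]quotmod_piK !quotmod_piZ scalerA. Qed.

Lemma quotmod_scale1 : left_id 1 quotmod_scale.
Proof. by move=> u; rewrite -[u]quotmod_piK quotmod_piZ scale1r. Qed.

Lemma quotmod_scaleDr : right_distributive quotmod_scale +%R.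
Proof.
move=> a u v; rewrite -[u]quotmod_piK -[v]quotmod_piK -quotmod_piD.
by rewrite !quotmod_piZ scalerDr quotmod_piD.
Qed.

Lemma quotmod_scaleDl u : {morph quotmod_scale^~ u : a b / a + b}.
Proof.
by move=> a b; rewrite -[u]quotmod_piK !quotmod_piZ scalerDl quotmod_piD.
Qed.

HB.instance Definition _ := GRing.Zmodule_isLmodule.Build R quotmod
  quotmod_scaleA quotmod_scale1 quotmod_scaleDr quotmod_scaleDl.

Fact quotmod_pi_linear : linear quotmod_pi.
Proof. by move=> a x y; rewrite quotmod_piD -quotmod_piZ. Qed.

HB.instance Definition _ :=
  GRing.isLinear.Build R G quotmod *:%R quotmod_pi quotmod_pi_linear.

End Submodules.

Section Ideals.
Variable R : comPzRingType.
Implicit Types I J X : set R.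

Definition ideal I : Prop :=
  [/\ I 0, forall x y, I x -> I y -> I (x + y) & forall a x, I x -> I (a * x)].

Definition ideal_gen X : set R := smallest ideal X.

Definition noetherian : Prop :=
  forall I, ideal I -> exists s : seq R, I = ideal_gen [set` s].

Definition ideal_isom I J : Prop :=
  exists f : R -> R,
    [/\ forall x y, I x -> I y -> f (x + y) = f x + f y,
        forall a x, I x -> f (a * x) = a * f x
      & set_bij I J f].

Definition regular_sequence (s : seq R) : Prop :=
  (forall i x, (i < size s)%N ->
     ideal_gen [set` take i s] (s`_i * x) -> ideal_gen [set` take i s] x)
  /\ ~ ideal_gen [set` s] 1.

(* The unit ideal has infinite grade. *)
Definition grade_ge I (n : nat) : Prop :=
  I 1 \/ exists s : seq R,
    [/\ size s = n, [set` s] `<=` I & regular_sequence s].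

(* Row and column selections are arbitrary functions: a repeated index gives  *)
(* a zero minor, and a reordering only changes a sign. For k = 0 the unique   *)
(* minor is 1.                                                                *)
Definition minors_ideal (k m n : nat) (A : 'M[R]_(m, n)) : set R :=
  ideal_gen [set r | exists (f : 'I_k -> 'I_m) (g : 'I_k -> 'I_n),
                       r = \det (mxsub f g A)].

End Ideals.

Arguments noetherian : clear implicits.

Section Modules.
Variable R : comPzRingType.
Implicit Types M N P : lmodType R.

Definition isomorphic M N : Prop := exists f : {linear M -> N}, bijective f.

Definition finitely_generated M : Prop :=
  exists (n : nat) (v : 'I_n -> M),
    forall x, exists c : 'I_n -> R, x = \sum_(i < n) c i *: v i.

Definition torsionfree M : Prop :=
  forall (s : R) (x : M), GRing.lreg s -> s *: x = 0 -> x = 0.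

Definition annihilator M : set R := [set a | forall x : M, a *: x = 0].

Definition surjective (T U : Type) (f : T -> U) : Prop :=
  forall y, exists x, f x = y.

Definition exact_at M N P (f : M -> N) (g : N -> P) : Prop :=
  forall y, g y = 0 <-> exists x, f x = y.

(* The matrix A acts on row vectors, so its rows are the relations; it is the *)
(* transpose of the usual matrix of R^m -> R^n and has the same minors.       *)
Definition presentation M (m n : nat) (A : 'M[R]_(m, n))
    (p : {linear 'rV[R]_n -> M}) : Prop :=
  exact_at (fun u : 'rV[R]_m => u *m A) p /\ surjective p.

(* "I is the i-th Fitting ideal of M". The truncated n - i gives the unit     *)
(* ideal when i >= n. By Fitting's lemma, I does not depend on the            *)
(* presentation.                                                              *)
Definition fitting_ideal (i : nat) M (I : set R) : Prop :=
  exists (m n : nat) (A : 'M[R]_(m, n)) (p : {linear 'rV[R]_n -> M}),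
    presentation A p /\ I = minors_ideal (n - i) A.

Definition projective P : Prop :=
  forall M N (g : {linear M -> N}) (f : {linear P -> N}),
    surjective g -> exists h : {linear P -> M}, forall x, g (h x) = f x.

Definition proj_dim_le M (n : nat) : Prop :=
  exists (P : nat -> lmodType R) (d : forall i, {linear P i.+1 -> P i})
         (eps : {linear P 0%N -> M}),
    [/\ forall i, projective (P i),
        surjective eps, exact_at (d 0%N) eps, forall i, exact_at (d i.+1) (d i)
      & forall i, (n < i)%N -> forall x : P i, x = 0].

Definition proj_dim_eq M (n : nat) : Prop :=
  proj_dim_le M n /\ forall k, (k < n)%N -> ~ proj_dim_le M k.

Section Rank.
Variables (Q : comPzRingType) (phi : {rmorphism R -> Q}).

(* phi is the localization of R at the set of all nonzerodivisors. *)
Definition total_fraction_ring : Prop :=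
  [/\ injective phi,
      forall s : R, GRing.lreg s -> exists t : Q, phi s * t = 1
    & forall q : Q, exists (a s : R), GRing.lreg s /\ phi s * q = phi a].

(* The Q-module T, with x |-> tau x standing for x \otimes 1, is M \otimes_R Q. *)
Definition base_change M (T : lmodType Q)
    (tau : {linear M -> T | phi \; *:%R}) : Prop :=
  forall (N : lmodType Q) (g : {linear M -> N | phi \; *:%R}),
    exists h : {linear T -> N},
      (forall x, h (tau x) = g x)
      /\ forall h' : {linear T -> N}, (forall x, h' (tau x) = g x) -> h' =1 h.

End Rank.

(* M \otimes_R Q is isomorphic to Q^e, Q being unique up to isomorphism. *)
Definition has_rank M (e : nat) : Prop :=
  exists (Q : comPzRingType) (phi : {rmorphism R -> Q})
         (tau : {linear M -> 'rV[Q]_e | phi \; *:%R}),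
    total_fraction_ring phi /\ base_change tau.

Definition ideal_module (G : lmodType R) (E : submodClosed G) (e : nat) : Prop :=
  [/\ isomorphic G 'rV[R]_e, torsionfree (submod E)
    & grade_ge (annihilator (quotmod E)) 2].

End Modules.

(* Main.v *)
(* Over the total ring of fractions Q, a presentation matrix A of E presents the
   free module Q^e, so 1 = P S + C A with P having e columns; hence the ideal of
   (n - e)-minors of A contains 1 over Q, and F_e(E) contains a nonzerodivisor t.
   Then t F_0(G/E) is the required ideal.

   For the equality, let B be the matrix of a surjection from R^n onto E, seen in
   G = R^e, and A the matrix of its syzygies. The minors of A on a fixed set f of
   rows are proportional to the complementary minors of B, and the ratio a_f is
   in R because the annihilator of G/E contains a regular sequence x, y. If E has
   projective dimension 1, there is an idempotent W with W A = A which kills the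
   relations between the rows of A; the same argument gives
   det W_{f,s} = a_f b_s with b_s in R. Cauchy-Binet applied to A = W A yields
   a_f = a_f (sum_S b_S a_S), so the a_f generate the unit ideal, and the minors
   of A and of B generate the same ideal. To make the complementary index sets
   blocks, e zero generators are added to the presentation of E. *)
Require Import Defs.
From HB Require Import structures.
From mathcomp Require Import all_boot all_algebra.
From mathcomp Require Import boolp classical_sets functions.
From mathcomp Require Import perm ring.

Set Implicit Arguments.
Unset Strict Implicit.
Unset Printing Implicit Defensive.

Import GRing.Theory.
Local Open Scope ring_scope.

(** * Determinant of a product of rectangular matrices *)

Section Determinants.
Variable R : comPzRingType.

Lemma det_mulmx_ffun k m (X : 'M[R]_(k, m)) (Y : 'M[R]_(m, k)) :
  \det (X *m Y) =
  \sum_(f : {ffun 'I_k -> 'I_m}) (\prod_i X i (f i)) * \det (rowsub f Y).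
Proof.
pose XY (s : 'S_k) i j := X i j * Y j (s i).
transitivity (\sum_(f : {ffun 'I_k -> 'I_m}) \sum_(s : 'S_k)
                (-1) ^+ s * \prod_i XY s i (f i)).
  rewrite exchange_big; apply: eq_bigr => /= s _; rewrite -big_distrr /=.
  congr (_ * _); rewrite -(bigA_distr_bigA (XY s)) /=.
  by apply: eq_bigr => i _; rewrite mxE.
apply: eq_bigr => f _; rewrite /determinant big_distrr /=.
apply: eq_bigr => s _; rewrite big_split /= mulrCA.
by do 2 congr (_ * _); apply: eq_bigr => i _; rewrite mxE.
Qed.

(* [D] is a set of representatives of the injections modulo reordering. *)
Lemma Cauchy_Binet k m : exists D : {set {ffun 'I_k -> 'I_m}},
  forall (X : 'M[R]_(k, m)) (Y : 'M[R]_(m, k)),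
    \det (X *m Y) = \sum_(g in D) \det (colsub g X) * \det (rowsub g Y).
Proof.
pose F := {ffun 'I_k -> 'I_m}.
pose im (f : F) : {set 'I_m} := [set f i | i : 'I_k].
pose same (f g : F) := injectiveb g && (im g == im f).
pose rep (f : F) : F := odflt f [pick g : F | same f g].
have sameP (f : F) : injectiveb f -> same f (rep f).
  move=> inj_f; rewrite /rep; case: pickP => [g //|/(_ f)].
  by rewrite /same inj_f eqxx.
have rep_im (f g : F) : injectiveb f -> im f = im g -> rep f = rep g.
  move=> inj_f imfg; rewrite /rep.
  have <-: [pick h | same f h] = [pick h | same g h].
    by apply: eq_pick => h; rewrite /same imfg.
  by case: pickP => [//|/(_ f)]; rewrite /same inj_f eqxx.
exists [set g : F | injectiveb g && (rep g == g)] => X Y.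
rewrite det_mulmx_ffun (bigID (fun f : F => injectiveb f)) /= addrC.
rewrite big1 ?add0r => [|f /injectivePn[i1 [i2 Di12 Ef12]]]; last first.
  by rewrite (determinant_alternate Di12) ?mulr0 // => j; rewrite !mxE Ef12.
rewrite (partition_big rep (fun g => injectiveb g && (rep g == g))) /=;
  last first.
  move=> f inj_f; have /andP[inj_r /eqP im_r] := sameP f inj_f.
  by rewrite inj_r; apply/eqP/rep_im.
apply: eq_big => [g|g /andP[inj_g /eqP rep_g]]; first by rewrite inE.
(* [h] and [h'] match permutations with the injections having the image of [g], where the defaults
   [1] and [i] are never reached. *)
pose h (s : 'S_k) : F := [ffun i => g (s i)].
pose h' (f : F) : 'S_k :=
  insubd (1%g : 'S_k) [ffun i => odflt i [pick j | g j == f i]].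
have Ig := injectiveP _ inj_g.
have hK s : h' (h s) = s.
  apply/permP => i; rewrite -pvalE /h' insubdK.
    rewrite ffunE; case: pickP => [j|/(_ (s i))] /=.
      by rewrite ffunE => /eqP/Ig ->.
    by rewrite ffunE eqxx.
  move: i => _; apply/injectiveP => i j; rewrite !ffunE.
  case: pickP => [i' /eqP|/(_ (s i))]; last by rewrite eqxx.
  case: pickP => [j' /eqP|/(_ (s j))]; last by rewrite eqxx.
  by move=> /Ig -> /Ig -> /= /perm_inj.
rewrite (reindex_onto h h') /=; last first.
  move=> f /andP[/injectiveP inj_f /eqP rep_f].
  have /andP[_ /eqP im_r] := sameP f (introT (injectiveP _) inj_f).
  have gP i : exists j, g j = f i.
    have : f i \in im f by apply: imset_f.
    by rewrite -im_r rep_f => /imsetP[j _ ->]; exists j.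
  have pE i : g (odflt i [pick j | g j == f i]) = f i.
    case: pickP => [j /eqP //|none].
    by have [j /eqP] := gP i; rewrite none.
  apply/ffunP => i; rewrite ffunE -pvalE /h' insubdK ?ffunE //.
  apply/injectiveP => a b; rewrite !ffunE => /(congr1 g).
  by rewrite !pE => /inj_f.
rewrite [in RHS]/determinant big_distrl /=.
apply: eq_big => [s|s _].
  rewrite hK eqxx andbT; apply/andP; split.
    by apply/injectiveP => i j; rewrite !ffunE => /Ig/perm_inj.
  apply/eqP; rewrite -[RHS]rep_g; apply: rep_im.
    by apply/injectiveP => i j; rewrite !ffunE => /Ig/perm_inj.
  apply/setP => x; apply/imsetP/imsetP => -[i _ ->].
    by exists (s i); rewrite ?ffunE.
  by exists (s^-1 i)%g; rewrite ?ffunE ?permKV.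
have -> : rowsub (h s) Y = row_perm s (rowsub g Y).
  by apply/matrixP => i j; rewrite !mxE ffunE.
rewrite row_permE det_mulmx det_perm mulrA [_ * (-1) ^+ s]mulrC.
by congr (_ * _ * _); apply: eq_bigr => i _; rewrite !mxE ffunE.
Qed.

End Determinants.

Local Open Scope classical_set_scope.

(** * Ideals of minors under products and low-rank changes *)

Section IdealTheory.
Variable R : comPzRingType.
Implicit Types (I J X : set R) (a x y : R).

Lemma ideal_gen_ideal X : ideal (ideal_gen X).
Proof.
split=> [J [[J0 _ _] _] //|x y Ix Iy J JX|a x Ix J JX].
  by have [[_ D _] _] := JX; exact: D _ _ (Ix J JX) (Iy J JX).
by have [[_ _ M] _] := JX; exact: M _ _ (Ix J JX).
Qed.

Lemma sub_ideal_gen X : X `<=` ideal_gen X.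
Proof. by move=> x Xx J [_]; apply. Qed.

Lemma ideal_gen_sub X I : ideal I -> X `<=` I -> ideal_gen X `<=` I.
Proof. by move=> Iid XI x; apply. Qed.

Lemma ideal_sum I (T : Type) (r : seq T) (P : pred T) (F : T -> R) :
  ideal I -> (forall i, P i -> I (F i)) -> I (\sum_(i <- r | P i) F i).
Proof. by case=> I0 ID _ IF; elim/big_ind: _. Qed.

Lemma ideal_sign I (n : nat) x : ideal I -> I x -> I ((-1) ^+ n * x).
Proof. by case=> _ _; apply. Qed.

Lemma ideal_annihilator (z : R) : ideal [set a | z * a = 0].
Proof.
split=> [|a b /= za zb|c a /= za]; first by rewrite /= mulr0.
  by rewrite mulrDr za zb addr0.
by rewrite mulrCA za mulr0.
Qed.

Lemma ideal_gen_nil : ideal_gen [set` [::]] = [set (0 : R)].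
Proof.
apply/seteqP; split=> [|x ->]; last by case: (ideal_gen_ideal [set` [::]]).
apply: ideal_gen_sub => //.
split=> //= [x y -> ->|a x ->]; first by rewrite addr0.
by rewrite mulr0.
Qed.

Lemma ideal_gen1 x : ideal_gen [set` [:: x]] = [set a * x | a in setT].
Proof.
apply/seteqP; split; last first.
  move=> _ [a _ <-]; have [_ _] := ideal_gen_ideal [set` [:: x]]; apply.
  by apply: sub_ideal_gen; rewrite /= inE.
apply: ideal_gen_sub => [|y]; last first.
  by rewrite /= inE => /eqP ->; exists 1; rewrite ?mul1r.
split=> [|_ _ [a _ <-] [b _ <-]|c _ [a _ <-]]; first by exists 0; rewrite ?mul0r.
  by exists (a + b); rewrite ?mulrDl.
by exists (c * a); rewrite ?mulrA.
Qed.

Lemma minors_ideal_ideal k m n (A : 'M[R]_(m, n)) : ideal (minors_ideal k A).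
Proof. exact: ideal_gen_ideal. Qed.

Lemma minors_idealP k m n (A : 'M[R]_(m, n)) (f : 'I_k -> 'I_m)
    (g : 'I_k -> 'I_n) : minors_ideal k A (\det (mxsub f g A)).
Proof. by apply: sub_ideal_gen; exists f, g. Qed.

Lemma minors_ideal_sub k m n (A : 'M[R]_(m, n)) I : ideal I ->
  (forall f g, I (\det (mxsub f g A : 'M_k))) -> minors_ideal k A `<=` I.
Proof. by move=> Iid IA; apply: ideal_gen_sub => // _ [f [g ->]]. Qed.

Lemma minors_ideal0 m n (A : 'M[R]_(m, n)) a : minors_ideal 0 A a.
Proof.
have fm : 'I_0 -> 'I_m by case. have fn : 'I_0 -> 'I_n by case.
have := @minors_idealP _ _ _ A fm fn; rewrite det_mx00 -(mulr1 a).
by case: (minors_ideal_ideal 0 A) => _ _; apply.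
Qed.

Lemma minors_ideal_det n (A : 'M[R]_n) : minors_ideal n A (\det A).
Proof. by rewrite -{2}(mxsub_id A); apply: minors_idealP. Qed.

Lemma minors_ideal_mull k l m n (X : 'M[R]_(l, m)) (A : 'M[R]_(m, n)) :
  minors_ideal k (X *m A) `<=` minors_ideal k A.
Proof.
apply: minors_ideal_sub => [|f g]; first exact: minors_ideal_ideal.
rewrite mxsub_mul; have [D ->] := Cauchy_Binet R k m.
have Iid := minors_ideal_ideal k A; apply: ideal_sum => // h _.
by have [_ _] := Iid; apply; rewrite -mxsub_comp; apply: minors_idealP.
Qed.

Lemma minors_ideal_mulr k l m n (A : 'M[R]_(m, n)) (Y : 'M[R]_(n, l)) :
  minors_ideal k (A *m Y) `<=` minors_ideal k A.
Proof.
apply: minors_ideal_sub => [|f g]; first exact: minors_ideal_ideal.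
rewrite mxsub_mul; have [D ->] := Cauchy_Binet R k n.
have Iid := minors_ideal_ideal k A; apply: ideal_sum => // h _; rewrite mulrC.
by have [_ _] := Iid; apply; rewrite -mxsub_comp; apply: minors_idealP.
Qed.

Lemma row'_col'_mxsub k m n (A : 'M[R]_(m, n)) (f : 'I_k -> 'I_m)
    (g : 'I_k -> 'I_n) (i j : 'I_k) :
  row' i (col' j (mxsub f g A)) = mxsub (f \o lift i) (g \o lift j) A.
Proof. by apply/matrixP => a b; rewrite !mxE. Qed.

Lemma minors_idealS k m n (A : 'M[R]_(m, n)) :
  minors_ideal k.+1 A `<=` minors_ideal k A.
Proof.
apply: minors_ideal_sub => [|f g]; first exact: minors_ideal_ideal.
have Iid := minors_ideal_ideal k A.
rewrite (expand_det_row _ ord0); apply: ideal_sum => // j _.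
have [_ _] := Iid; apply; apply: (ideal_sign _ Iid).
by rewrite row'_col'_mxsub; apply: minors_idealP.
Qed.

Lemma minors_ideal_leq k l m n (A : 'M[R]_(m, n)) :
  (k <= l)%N -> minors_ideal l A `<=` minors_ideal k A.
Proof.
move=> /subnK <-; elim: (l - k)%N => // d IH x.
by rewrite addSn => /minors_idealS/IH.
Qed.

(** Clearing [p] with the corner 1 of the bordered matrix leaves the Schur complement
    [D + p *m s]. *)
Lemma det_rank1 n (D : 'M[R]_n) (p : 'cV[R]_n) (s : 'rV[R]_n) :
  \det (D + p *m s) = \det (block_mx 1%:M (- s) p D).
Proof.
have -> : block_mx 1%:M (- s) p D
        = block_mx 1%:M 0 p 1%:M *m block_mx (1%:M : 'M_1) (- s) 0 (D + p *m s).
  rewrite mulmx_block !mul1mx !mul0mx !mulmx1 !addr0.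
  by rewrite mulmxN addrCA addNr addr0.
by rewrite det_mulmx det_lblock det_ublock !det1 !mul1r.
Qed.

(** Expanding the bordered determinant, and then its minors, leaves in each term a factor that is a
    minor of [D] missing one row and one column. *)
Lemma det_rank1_ideal I n (D : 'M[R]_n.+1) (p : 'cV[R]_n.+1)
    (s : 'rV[R]_n.+1) : ideal I ->
  (forall i j, I (\det (row' i (col' j D)))) -> I (\det (D + p *m s)).
Proof.
move=> Iid ID; have [_ Iadd IM] := Iid.
have Icof i j : I (cofactor D i j).
  exact: ideal_sign.
have rE (c : 'I_n.+1) : lift (lshift n.+1 (0 : 'I_1)) c = rshift 1 c.
  exact: val_inj.
rewrite det_rank1 (expand_det_row _ (lshift _ ord0)) big_split_ord /=.
apply: (Iadd); apply: ideal_sum => // j _; apply: (IM);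
  apply: (ideal_sign _ Iid).
  suff -> : row' (lshift n.+1 0)
      (col' (lshift n.+1 j) (block_mx 1%:M (- s) p D)) = D.
    by rewrite (expand_det_row _ ord0); apply: ideal_sum => // i _; apply: (IM).
  apply/matrixP => a b; rewrite 2!mxE !ord1.
  by rewrite !rE block_mxEdr.
set M := row' _ _.
rewrite (expand_det_col _ 0); apply: ideal_sum => // i _; apply: (IM).
apply: (ideal_sign _ Iid).
suff -> : row' i (col' 0 M) = row' i (col' j D) by [].
apply/matrixP => a b; rewrite /M 4![in LHS]mxE 2![RHS]mxE rE.
have -> : lift (rshift 1 j) (lift 0 b) = rshift 1 (lift j b).
  by apply: val_inj; rewrite /= /bump /= !add1n ltnS addnS.
by rewrite block_mxEdr.
Qed.

Lemma minors_ideal_rank1 k m n (A : 'M[R]_(m, n)) (p : 'cV[R]_m)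
    (s : 'rV[R]_n) : minors_ideal k (A + p *m s) `<=` minors_ideal k.-1 A.
Proof.
case: k => [|k] x; first by move=> _; apply: minors_ideal0.
move: x; apply: minors_ideal_sub => [|f g]; first exact: minors_ideal_ideal.
have -> : mxsub f g (A + p *m s) = mxsub f g A + rowsub f p *m colsub g s.
  by rewrite -mxsub_mul; apply/matrixP => i j; rewrite !mxE.
apply: det_rank1_ideal => [|i j]; first exact: minors_ideal_ideal.
by rewrite row'_col'_mxsub; apply: minors_idealP.
Qed.

(** [P *m S] is a sum of [e] column-by-row products, each lowering the size of the minors by at most
    one. *)
Lemma minors_ideal_rank k m n e (A : 'M[R]_(m, n)) (P : 'M[R]_(m, e))
    (S : 'M[R]_(e, n)) :
  minors_ideal k (A + P *m S) `<=` minors_ideal (k - e) A.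
Proof.
elim: e => [|e IH] in k P S *; first by rewrite thinmx0 mul0mx addr0 subn0.
move: P S; rewrite -[e.+1]add1n => P S.
rewrite -[P]hsubmxK -[S]vsubmxK mul_row_col addrCA addrA [_ + A]addrC.
rewrite -addrA [_ + rsubmx P *m _]addrC addrA => x /minors_ideal_rank1/IH.
by rewrite add1n -subn1 -subnDA add1n.
Qed.

(* A block of [l] columns can absorb at most [l] of the rows of a minor. *)
Lemma minors_ideal_row_mx k l m n (A : 'M[R]_(m, n)) (V : 'M[R]_(m, l)) :
  minors_ideal k (row_mx A V) `<=` minors_ideal (k - l) A.
Proof.
have -> : row_mx A V = A *m row_mx 1%:M 0 + V *m row_mx 0 1%:M.
  by rewrite !mul_mx_row !mulmx1 !mulmx0 add_row_mx addr0 add0r.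
by move=> x /minors_ideal_rank/minors_ideal_mulr.
Qed.

End IdealTheory.

(** * Presentations and Fitting's lemma *)

Section Presentations.
Variable R : comPzRingType.
Implicit Types M : lmodType R.

Lemma linear_rV_sum M n (p : {linear 'rV[R]_n -> M}) (u : 'rV[R]_n) :
  p u = \sum_j u 0 j *: p (delta_mx 0 j).
Proof.
rewrite {1}(row_sum_delta u) linear_sum.
by apply: eq_bigr => j _; rewrite linearZ.
Qed.

Lemma lift_matrix M n n' (p : {linear 'rV[R]_n -> M})
    (p' : {linear 'rV[R]_n' -> M}) : Defs.surjective p' ->
  exists S : 'M[R]_(n, n'), forall u, p' (u *m S) = p u.
Proof.
move=> p'_surj.
have /choice[s sE] (i : 'I_n) : exists v, p' v = p (delta_mx 0 i).
  exact: p'_surj.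
exists (\matrix_i s i) => u.
rewrite mulmx_sum_row linear_sum [RHS]linear_rV_sum.
by apply: eq_bigr => i _; rewrite linearZ rowK sE.
Qed.

Lemma factor_matrix M m n k (A : 'M[R]_(m, n)) (p : {linear 'rV[R]_n -> M})
    (X : 'M[R]_(k, n)) :
  exact_at (fun u : 'rV[R]_m => u *m A) p -> (forall u, p (u *m X) = 0) ->
  exists Z : 'M[R]_(k, m), X = Z *m A.
Proof.
move=> Ap pX.
have /choice[z zE] (i : 'I_k) : exists v : 'rV[R]_m, v *m A = row i X.
  by apply/Ap; rewrite rowE.
exists (\matrix_i z i); apply/row_matrixP => i.
by rewrite row_mul rowK zE.
Qed.

Lemma exact_at_mulmx M m n (A : 'M[R]_(m, n)) (p : {linear 'rV[R]_n -> M}) :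
  exact_at (fun u : 'rV[R]_m => u *m A) p -> forall u, p (u *m A) = 0.
Proof. by move=> Ap u; apply/Ap; exists u. Qed.

(** [S] and [T] translate between the generators, so [1 - S *m T] and [A' *m T] factor through [A].
    Exchanging the presentations gives the other inclusion. *)
Lemma minors_ideal_presentation_sub M i m n (A : 'M[R]_(m, n))
    (p : {linear 'rV[R]_n -> M}) m' n' (A' : 'M[R]_(m', n'))
    (p' : {linear 'rV[R]_n' -> M}) :
  presentation A p -> presentation A' p' ->
  minors_ideal (n' - i) A' `<=` minors_ideal (n - i) A.
Proof.
move=> [Ap p_surj] [A'p' p'_surj].
have [S SE] := lift_matrix p p'_surj; have [T TE] := lift_matrix p' p_surj.
have [Y YE] : exists Y, 1%:M - S *m T = Y *m A.
  apply: factor_matrix Ap _ => u.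
  by rewrite mulmxBr linearB mulmx1 mulmxA TE SE subrr.
have [X XE] : exists X, A' *m T = X *m A.
  by apply: factor_matrix Ap _ => u; rewrite mulmxA TE exact_at_mulmx.
apply: minors_ideal_sub => [|f g]; first exact: minors_ideal_ideal.
set D := rowsub f A'; have DT : D *m T = rowsub f X *m A.
  by rewrite !mul_rowsub_mx XE.
(* Multiplying by [V] gives a block triangular matrix with diagonal blocks 1 and the chosen
   submatrix of [A']. *)
pose V := block_mx 1%:M 0 (- T) (colsub g 1%:M).
have det_D : \det (mxsub f g A') =
    \det (row_mx (col_mx Y (rowsub f X) *m A) (col_mx (- S) D) *m V).
  rewrite mul_col_mx -YE -DT mul_row_block mulmx0 add0r !mul_col_mx !mulmx1.
  rewrite add_col_mx !mulmxN mulNmx opprK subrK subrr -block_mxEh.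
  by rewrite !mulmx_colsub !mulmx1 det_ublock det1 mul1r -mxsub_comp.
(* The last [n'] columns absorb up to [n'] rows. For [n' <= i] the size left is [n - n'], still at
   least [n - i]. *)
rewrite det_D; apply: (@minors_ideal_leq _ _ (n + (n' - i) - n')).
  have [n'i|in'] := leqP n' i; last first.
    by rewrite (addnBA _ (ltnW in')) -subnDA subnDr.
  by move: (n'i); rewrite -subn_eq0 => /eqP ->; rewrite addn0 leq_sub2l.
set N := _ *m V; have := @minors_ideal_det _ _ N.
by move=> /minors_ideal_mulr/minors_ideal_row_mx/minors_ideal_mull.
Qed.

Lemma fitting_idealE M i (I : set R) m n (A : 'M[R]_(m, n))
    (p : {linear 'rV[R]_n -> M}) :
  presentation A p -> fitting_ideal i M I -> I = minors_ideal (n - i) A.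
Proof.
move=> Ap [m' [n' [A' [p' [A'p' ->]]]]].
by apply/seteqP; split; [exact: (minors_ideal_presentation_sub Ap A'p')
                        |exact: (minors_ideal_presentation_sub A'p' Ap)].
Qed.

End Presentations.

(** * Regular pairs and their powers *)

Section RegularPairs.
Variable R : comPzRingType.
Implicit Types x y : R.

(** The pair [1, 1] is allowed, which covers the unit ideal. *)
Definition regular_pair x y : Prop :=
  GRing.lreg x /\ forall z w, y * z = x * w -> exists v, z = x * v.

Lemma lreg_mul_eq0 x z : GRing.lreg x -> x * z = 0 -> z = 0.
Proof. by move=> regx xz; apply: regx; rewrite mulr0. Qed.

Lemma regular_pairX x y k l :
  regular_pair x y -> regular_pair (x ^+ k) (y ^+ l).
Proof.
case=> regx regy; split=> [|z w]; first exact: GRing.lregX.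
have regyl t u : y ^+ l * t = x * u -> exists v, t = x * v.
  elim: l t u => [|l IH] t u; first by rewrite mul1r; exists u.
  by rewrite exprS -mulrA => /regy[v]; apply: IH.
elim: k z w => [|k IH] z w; first by exists z; rewrite mul1r.
rewrite exprS => yz; have [v zE] : exists v, z = x * v.
  by apply: (regyl _ (x ^+ k * w)); rewrite yz mulrA.
move: yz; rewrite zE mulrCA -mulrA => /regx/IH[v' ->].
by exists v'; rewrite mulrA.
Qed.

End RegularPairs.

(** * Complementary minors *)

Section ComplementaryMinors.
Variables (R : comPzRingType) (e n : nat).

Lemma det_col_mx_row_mx x (P : 'M[R]_(e + n, e)) (C : 'M[R]_(e, e + n))
    (D : 'M[R]_(n, e + n)) (Y : 'M[R]_(e + n, n)) :
  C *m P = x%:M -> D *m P = 0 ->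
  \det (col_mx C D) * \det (row_mx P Y) = x ^+ e * \det (D *m Y).
Proof.
move=> CP DP; rewrite -det_mulmx mul_col_row CP DP.
by rewrite det_ublock det_scalar.
Qed.

(** With [H] selecting rows, this makes a minor of [B] a value of the complementary determinant. *)
Lemma det_row_mx_complement (B : 'M[R]_(n, e)) (H : 'M[R]_(e, n)) :
  \det (row_mx (col_mx 0 B) (col_mx (- H) 1%:M)) = \det (H *m B).
Proof.
rewrite -block_mxEh.
have -> : block_mx 0 (- H) B 1%:M
        = block_mx 1%:M (- H) 0 1%:M *m block_mx (H *m B) 0 B 1%:M.
  rewrite mulmx_block !mul1mx !mul0mx !mulmx1 !add0r.
  by rewrite mulNmx subrr.
by rewrite det_mulmx det_ublock det_lblock !det1 !mul1r mulr1.
Qed.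

Lemma minors_ideal_row_mx_complement (B : 'M[R]_(n, e))
    (Y : 'M[R]_(e + n, n)) :
  minors_ideal e B (\det (row_mx (col_mx 0 B) Y)).
Proof.
have := @minors_ideal_det _ _ (row_mx (col_mx 0 B) Y).
move=> /minors_ideal_row_mx; rewrite addnK.
have -> : col_mx 0 B = col_mx 0 1%:M *m B :> 'M_(e + n, e).
  by rewrite mul_col_mx mul0mx mul1mx.
exact: minors_ideal_mull.
Qed.

(* Both determinants represent the same line in the [n]-th exterior power, so
   they differ by an element of the total ring of fractions with denominators
   [x ^+ e] and [y ^+ e]; it lies in [R] because [x, y] is a regular sequence. *)
Lemma complementary_ratio x y (B : 'M[R]_(n, e)) (Cx Cy : 'M[R]_(e, n))
    (D : 'M[R]_(n, e + n)) :
  regular_pair x y -> Cx *m B = x%:M -> Cy *m B = y%:M ->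
  D *m col_mx 0 B = 0 ->
  exists a, forall Y, \det (D *m Y) = a * \det (row_mx (col_mx 0 B) Y).
Proof.
move=> xy CxB CyB DB; have [regx _] := xy.
have [regxe regye] := regular_pairX e e xy.
have padB z (C : 'M[R]_(e, n)) : C *m B = z%:M ->
      (row_mx 0 C : 'M_(e, e + n)) *m col_mx 0 B = z%:M.
  by move=> <-; rewrite mul_row_col mul0mx add0r.
have Ex := det_col_mx_row_mx _ (padB _ _ CxB) DB.
have Ey := det_col_mx_row_mx _ (padB _ _ CyB) DB.
set dx := \det (col_mx _ D) in Ex; set dy := \det (col_mx _ D) in Ey.
(* At a [Y] where the determinant with [B] is [x ^+ e], the two identities give
   [y ^+ e * dx = x ^+ e * dy]. *)
have [a dxE] : exists a, dx = x ^+ e * a.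
  apply: (regye _ dy); apply: regxe.
  have := Ex (col_mx (- Cx) 1%:M); have := Ey (col_mx (- Cx) 1%:M).
  rewrite det_row_mx_complement CxB det_scalar => Ey' Ex'.
  by rewrite mulrCA [x ^+ e * dx]mulrC Ex' mulrCA -Ey' [dy * _]mulrC.
exists a => Y; apply: regxe.
by rewrite -Ex dxE mulrA.
Qed.

End ComplementaryMinors.

(** * Minors of generators and of split syzygies *)

Section SplitSyzygies.
Variables (R : comPzRingType) (e n m : nat).
Variables (B : 'M[R]_(n, e)) (A : 'M[R]_(m, e + n)) (W : 'M[R]_m).
Variables (x y : R) (Cx Cy : 'M[R]_(e, n)).
Hypothesis xy : regular_pair x y.
Hypotheses (CxB : Cx *m B = x%:M) (CyB : Cy *m B = y%:M).
Hypothesis AB : A *m col_mx 0 B = 0.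
Hypothesis factorA : forall k (X : 'M[R]_(k, e + n)),
  X *m col_mx 0 B = 0 -> exists Z, X = Z *m A.
Hypothesis WA : W *m A = A.
Hypothesis kerW : forall k (X : 'M[R]_(k, m)), X *m A = 0 -> X *m W = 0.

Let beta (Y : 'M[R]_(e + n, n)) := \det (row_mx (col_mx 0 B) Y).

(** The rows of [z%:M - col_mx 0 B *m row_mx 0 C] are syzygies. Then [A *m Z - z%:M] kills [A] from
    the left, hence also [W]. *)
Let syzygy_splitting z (C : 'M[R]_(e, n)) : C *m B = z%:M ->
  exists Z, Z *m A = z%:M - col_mx 0 B *m row_mx 0 C /\ A *m (Z *m W) = z *: W.
Proof.
move=> CB; set B' := col_mx 0 B; set C' := row_mx 0 C.
have CB' : C' *m B' = z%:M by rewrite mul_row_col mul0mx add0r.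
have [Z ZE] : exists Z, z%:M - B' *m C' = Z *m A.
  by apply: factorA; rewrite mulmxBl -mulmxA CB' scalar_mxC subrr.
exists Z; split=> //; apply/eqP.
rewrite -subr_eq0 mulmxA -mul_scalar_mx -mulmxBl.
apply/eqP/kerW; rewrite mulmxBl -mulmxA -ZE mulmxBr mulmxA AB mul0mx subr0.
by rewrite scalar_mxC subrr.
Qed.

(** [x%:M] is a multiple of [A] plus a product through [R^e], so the nonzerodivisor [x ^+ (e + n)]
    lies in the ideal of [n]-minors of [A]. *)
Let cancel_minors z :
  (forall (f : 'I_n -> 'I_m) Y, z * \det (rowsub f A *m Y) = 0) -> z = 0.
Proof.
move=> zA; have [Z [ZA _]] := syzygy_splitting CxB; have [regx _] := xy.
apply: (@lreg_mul_eq0 _ (x ^+ (e + n))); first exact: GRing.lregX.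
rewrite mulrC.
suff : minors_ideal n A `<=` [set a | z * a = 0].
  apply; rewrite -det_scalar.
  have -> : x%:M = Z *m A + col_mx 0 B *m row_mx 0 Cx by rewrite ZA subrK.
  set N := _ + _; have := @minors_ideal_det _ _ N.
  by move=> /minors_ideal_rank; rewrite addKn => /minors_ideal_mull.
apply: minors_ideal_sub => [|f g]; first exact: ideal_annihilator.
have -> : mxsub f g A = rowsub f A *m colsub g 1%:M.
  by rewrite -mxsub_mul mulmx1.
exact: zA.
Qed.

Lemma minors_ideal_complement : minors_ideal n A = minors_ideal e B.
Proof.
have /choice[a aE] (f : 'I_n -> 'I_m) :
    exists a, forall Y, \det (rowsub f A *m Y) = a * beta Y.
  apply: (complementary_ratio xy CxB CyB).
  by rewrite mul_rowsub_mx AB; apply/matrixP => i j; rewrite !mxE.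
(* Since [A *m (Z *m W) = z *: W], the formula [aE] computes the minors of [W] up to [z ^+ n]. *)
have scaleW z (C : 'M[R]_(e, n)) : C *m B = z%:M ->
    exists T : 'M[R]_(e + n, m), forall (f s : 'I_n -> 'I_m),
      z ^+ n * \det (mxsub f s W) = a f * beta (colsub s T).
  move=> /syzygy_splitting[Z [_ AZW]]; exists (Z *m W) => f s.
  rewrite -aE -mxsub_mul AZW -detZ; congr (\det _).
  by apply/matrixP => i j; rewrite !mxE.
have [Tx TxE] := scaleW _ _ CxB; have [Ty TyE] := scaleW _ _ CyB.
have [regxn regyn] := regular_pairX n n xy.
have /choice[b bE] (s : 'I_n -> 'I_m) :
    exists b, forall f, \det (mxsub f s W) = a f * b.
  (* [y ^+ n * beta (colsub s Tx) - x ^+ n * beta (colsub s Ty)] kills every [n]-minor of [A], so it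
     vanishes. *)
  have [b bE] : exists b, beta (colsub s Tx) = x ^+ n * b.
    apply: (regyn _ (beta (colsub s Ty))).
    apply/eqP; rewrite -subr_eq0; apply/eqP.
    apply: cancel_minors => f Y.
    rewrite aE mulrA mulrBl -[y ^+ n * _ * _]mulrA -[x ^+ n * _ * _]mulrA.
    by rewrite ![beta _ * a f]mulrC -TxE -TyE mulrCA subrr mul0r.
  by exists b => f; apply: regxn; rewrite TxE bE mulrCA.
have [D DE] := Cauchy_Binet R n m.
(* By Cauchy-Binet for [W *m A], one minus the sum kills every [n]-minor of [A]. *)
have one : 1 = \sum_(S in D) b S * a S.
  apply/eqP; rewrite -subr_eq0; apply/eqP; apply: cancel_minors => f Y.
  rewrite mulrBl mul1r -{1}WA -mul_rowsub_mx -mulmxA DE big_distrl /=.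
  apply/eqP; rewrite subr_eq0; apply/eqP; apply: eq_bigr => S _.
  by rewrite -mxsub_comp bE -mul_rowsub_mx !aE; ring.
have Aid := minors_ideal_ideal n A; have Bid := minors_ideal_ideal e B.
have [_ _ AM] := Aid; have [_ _ BM] := Bid.
apply/seteqP; split; apply: minors_ideal_sub => // f g.
  have -> : mxsub f g A = rowsub f A *m colsub g 1%:M.
    by rewrite -mxsub_mul mulmx1.
  by rewrite aE; apply: BM; apply: minors_ideal_row_mx_complement.
(* As [B] has [e] columns, choosing columns multiplies by a square matrix. A value of [beta]
   remains, and [one] turns it into a combination of determinants [a S * beta _] coming from [A]. *)
have -> : mxsub f g B = (rowsub f 1%:M *m B) *m colsub g 1%:M.
  by rewrite mul_rowsub_mx mul1mx -mxsub_mul mulmx1.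
rewrite det_mulmx mulrC; apply: (AM); rewrite -det_row_mx_complement -/(beta _).
rewrite -[beta _]mul1r one big_distrl /=; apply: ideal_sum => // S _.
rewrite -mulrA -aE; apply: (AM).
set N := _ *m _; have := @minors_ideal_det _ _ N.
move=> /minors_ideal_mulr; rewrite -[A in rowsub _ A]mul1mx -mul_rowsub_mx.
exact: minors_ideal_mull.
Qed.

End SplitSyzygies.

(** * Linear maps from formulas, and row spans *)

Lemma linear_exists (S : pzRingType) (U : lmodType S) (V : zmodType)
    (s : GRing.Scale.law S V) (f : U -> V) :
  linear_for s f -> exists g : {linear U -> V | s}, g =1 f.
Proof.
move=> fl.
by exists (HB.pack_for {linear U -> V | s} f
  (GRing.isLinear.Build S U V s f fl)).
Qed.

Section RowSpan.
Variables (R : pzRingType) (m n : nat) (A : 'M[R]_(m, n)).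

(** Classical truth values make membership boolean, so that [submod] and [quotmod] apply. *)
Definition row_span : {pred 'rV[R]_n} := [pred v | `[< exists u, u *m A = v >]].

Lemma row_spanP v : reflect (exists u, u *m A = v) (v \in row_span).
Proof. exact: asboolP. Qed.

Fact row_span_submod_closed : submod_closed row_span.
Proof.
split=> [|a _ _ /row_spanP[u <-] /row_spanP[v <-]]; apply/row_spanP.
  by exists 0; rewrite mul0mx.
by exists (a *: u + v); rewrite mulmxDl scalemxAl.
Qed.

HB.instance Definition _ :=
  GRing.isSubmodClosed.Build R 'rV[R]_n row_span row_span_submod_closed.

End RowSpan.

(** * Splitting the syzygies in projective dimension at most one *)

Section ProjectiveDimension.
Variable R : comPzRingType.
Implicit Types M P : lmodType R.

(** [projective] lifts along surjections, so the codomain is cut down to the row span of [A]. *)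
Lemma projective_lift_matrix P m n (A : 'M[R]_(m, n))
    (f : {linear P -> 'rV[R]_n}) :
  projective P -> (forall x, exists u : 'rV[R]_m, u *m A = f x) ->
  exists h : {linear P -> 'rV[R]_m}, forall x, h x *m A = f x.
Proof.
move=> projP fA; pose K := submod (row_span A).
have spanA u : u *m A \in row_span A by apply/row_spanP; exists u.
have spanf x : f x \in row_span A by apply/row_spanP.
have [g gE] : exists g : {linear 'rV[R]_m -> K}, g =1 fun u => Submod (spanA u).
  apply: linear_exists => a u v; apply: val_inj.
  by rewrite /= mulmxDl scalemxAl.
have [f' f'E] : exists f' : {linear P -> K}, f' =1 fun x => Submod (spanf x).
  by apply: linear_exists => a x y; apply: val_inj; rewrite /= linearP.
have g_surj : Defs.surjective g.
  move=> [v vA]; have /row_spanP[u uv] := vA; exists u.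
  by rewrite gE; apply: val_inj.
have [h hE] := projP _ _ g f' g_surj.
by exists h => x; have /(congr1 val) := hE x; rewrite gE f'E.
Qed.

(* Schanuel's comparison of two presentations: the syzygies are a retract of the
   direct sum of [P 1] and ['rV_n], hence projective; [W] is the matrix of a
   splitting of the projection from ['rV_m] onto them. *)
Lemma proj_dim_le1_split M m n (A : 'M[R]_(m, n)) (p : {linear 'rV[R]_n -> M}) :
  presentation A p -> proj_dim_le M 1 ->
  exists W : 'M[R]_m, W *m A = A /\
    forall k (X : 'M[R]_(k, m)), X *m A = 0 -> X *m W = 0.
Proof.
move=> [Ap p_surj] [P [d [eps [projP eps_surj d_eps dd P0]]]].
have d_inj w : d 0%N w = 0 -> w = 0.
  by move/(dd 0%N) => [z <-]; rewrite (P0 2%N isT z) linear0.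
have pA := exact_at_mulmx Ap.
have /choice[a aE] (i : 'I_n) : exists x, eps x = p (delta_mx 0 i).
  exact: eps_surj.
(* [alpha] and [gamma] lift the identity of [M] in both directions between ['rV_n] and [P 0]. *)
have [alpha alphaE] : exists alpha : {linear 'rV[R]_n -> P 0%N},
    alpha =1 fun u => \sum_i u 0 i *: a i.
  apply: linear_exists => c u v; rewrite /= scaler_sumr -big_split /=.
  by apply: eq_bigr => i _; rewrite !mxE scalerDl scalerA.
have eps_alpha u : eps (alpha u) = p u.
  rewrite alphaE linear_sum [RHS]linear_rV_sum.
  by apply: eq_bigr => i _; rewrite linearZ aE.
have [gamma gammaE] := projP 0%N _ _ p eps p_surj.
have [lam lamE] : exists lam : {linear P 1%N -> 'rV[R]_m},
    forall w, lam w *m A = gamma (d 0%N w).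
  apply: (@projective_lift_matrix _ _ _ A (gamma \o d 0%N)) => // w.
  by apply/Ap; rewrite gammaE; apply/d_eps; exists w.
(* [G] is the matrix of [gamma \o alpha]; [Mu] is a homotopy from it to the identity. *)
pose G := \matrix_i gamma (a i).
have GE u : u *m G = gamma (alpha u).
  rewrite mulmx_sum_row alphaE linear_sum.
  by apply: eq_bigr => i _; rewrite linearZ rowK.
have [Mu MuE] : exists Mu, 1%:M - G = Mu *m A.
  apply: factor_matrix Ap _ => u.
  by rewrite mulmxBr mulmx1 linearB GE gammaE eps_alpha subrr.
have /choice[w wE] (i : 'I_m) : exists w, d 0%N w = alpha (row i A).
  by apply/d_eps; rewrite eps_alpha rowE pA.
(* Times [A], the first term gives [A *m G] and the second [A - A *m G]. *)
exists (\matrix_i lam (w i) + A *m Mu); split.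
  apply/row_matrixP => i.
  rewrite mulmxDl -mulmxA -MuE mulmxBr mulmx1 linearD linearB /= row_mul rowK.
  by rewrite lamE wE -GE row_mul addrC subrK.
move=> k X XA; rewrite mulmxDr mulmxA XA mul0mx addr0.
apply/row_matrixP => i; rewrite row_mul row0 mulmx_sum_row.
under eq_bigr do rewrite rowK -linearZ.
(* [d 0] sends [v] to [alpha] of row [i] of [X *m A], which is 0. *)
rewrite -linear_sum; set v := \sum_i _; suff -> : v = 0 by rewrite linear0.
apply: d_inj; rewrite linear_sum.
under eq_bigr do rewrite linearZ /= wE -linearZ.
by rewrite -linear_sum -mulmx_sum_row -row_mul XA row0 linear0.
Qed.

End ProjectiveDimension.

(** * A nonzerodivisor in the ideal of minors, from the rank *)

Section Rank.
Variable R : comPzRingType.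

(** The extension of [I] to [Q], written with fractions so that a nonzerodivisor of [I] can be read
    off from 1. *)
Lemma total_fraction_ring_ideal (Q : comPzRingType) (phi : {rmorphism R -> Q})
    (I : set R) : total_fraction_ring phi -> ideal I ->
  ideal [set q | exists s a, [/\ GRing.lreg s, I a & phi s * q = phi a]].
Proof.
move=> [_ _ fracQ] [I0 ID IM]; split.
- by exists 1, 0; split=> //; [exact: GRing.lreg1|rewrite mulr0 rmorph0].
- move=> q r [s [a [regs Ia sq]]] [t [b [regt Ib tr]]].
  exists (s * t), (t * a + s * b); split.
  + exact: GRing.lregM.
  + by apply: ID; apply: IM.
  + by rewrite rmorphD !rmorphM -sq -tr; ring.
- move=> c q [s [a [regs Ia sq]]]; have [b [t [regt tc]]] := fracQ c.
  exists (s * t), (b * a); split; [exact: GRing.lregM|exact: IM|].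
  by rewrite !rmorphM -sq -tc; ring.
Qed.

Lemma has_rank_lreg_minor (M : lmodType R) e m n (A : 'M[R]_(m, n))
    (p : {linear 'rV[R]_n -> M}) :
  presentation A p -> has_rank M e ->
  exists t, minors_ideal (n - e) A t /\ GRing.lreg t.
Proof.
move=> [Ap p_surj] [Q [phi [tau [fracQ univ]]]].
pose AQ := map_mx phi A; pose N := quotmod (row_span AQ).
pose pi : {linear 'rV[Q]_n -> N} := @quotmod_pi _ _ (row_span AQ).
have /choice[r rE] := p_surj.
have piE u : pi (map_mx phi (r (p u))) = pi (map_mx phi u).
  apply/quotmod_eqE; rewrite -map_mxB; apply/row_spanP.
  have [v <-] : exists v, v *m A = r (p u) - u.
    by apply/Ap; rewrite linearB rE subrr.
  by exists (map_mx phi v); rewrite map_mxM.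
(* [g] is induced by [p], the choice of [r] being harmless by [piE]; [h] extends it along [tau]. *)
have [g gE] : exists g : {linear M -> N | phi \; *:%R},
    g =1 fun x => pi (map_mx phi (r x)).
  apply: linear_exists => a x y.
  rewrite -[in LHS](rE x) -[in LHS](rE y) -linearP piE map_mxD map_mxZ.
  exact: linearP.
have [h [hE _]] := univ N g.
have /choice[s sE] (i : 'I_e) : exists v, pi v = h (delta_mx 0 i).
  by exists (quotmod_repr (h (delta_mx 0 i))); apply: quotmod_piK.
pose S := \matrix_i s i; pose P := \matrix_i tau (p (delta_mx 0 i)).
have hS v : h v = pi (v *m S).
  rewrite linear_rV_sum mulmx_sum_row linear_sum.
  by apply: eq_bigr => i _; rewrite rowK linearZ sE.
(* Row [i] of [P *m S] represents the same class in [N] as the [i]-th basis vector. *)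
have /choice[z zE] (i : 'I_n) : exists u, u *m AQ = row i (1%:M - P *m S).
  apply/row_spanP; rewrite linearB /= row1 row_mul rowK.
  apply/quotmod_eqE; rewrite -/pi -hS hE gE piE.
  by rewrite map_delta_mx.
have oneE : 1%:M = \matrix_i z i *m AQ + P *m S.
  apply/eqP; rewrite -subr_eq; apply/eqP/row_matrixP => i.
  by rewrite row_mul rowK zE.
have : minors_ideal (n - e) AQ 1.
  rewrite -(det1 Q n) oneE; set N' := _ + _; have := @minors_ideal_det _ _ N'.
  by move=> /minors_ideal_rank/minors_ideal_mull.
have Aid := minors_ideal_ideal (n - e) A.
move/(minors_ideal_sub (total_fraction_ring_ideal fracQ Aid)).
case=> [f g'|t [a [regt Ia]]].
  exists 1, (\det (mxsub f g' A)); split; first exact: GRing.lreg1.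
    exact: minors_idealP.
  by rewrite rmorph1 mul1r -det_map_mx map_mxsub.
have [phi_inj _ _] := fracQ.
by rewrite mulr1 => /phi_inj ta; exists t; rewrite {1}ta.
Qed.

End Rank.

(** * Regular pairs from the grade; padded presentations *)

Lemma grade_ge2_regular_pair (R : comPzRingType) (I : set R) :
  grade_ge I 2 -> exists x y, [/\ I x, I y & regular_pair x y].
Proof.
case=> [I1|[s [ss sI [regs _]]]].
  exists 1, 1; split=> //; split=> [|z w]; first exact: GRing.lreg1.
  by exists z; rewrite mul1r.
case: s => [|x [|y []]] // in ss sI regs *.
exists x, y; split; [by apply: sI; rewrite /= !inE eqxx ?orbT..|].
split=> [u v /= xuv|z w yz].
  apply/eqP; rewrite -subr_eq0; apply/eqP.
  (* Index 0 means modulo the ideal of the empty list, which is zero. *)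
  have := regs 0%N (u - v) isT; rewrite /= ideal_gen_nil; apply => /=.
  by rewrite mulrBr xuv subrr.
have := regs 1%N z isT; rewrite /= ideal_gen1 => -[|v _ <-].
  by exists w; rewrite // yz mulrC.
by exists v; rewrite mulrC.
Qed.

Lemma presentation_pad (R : comPzRingType) (M : lmodType R) e m n
    (A : 'M[R]_(m, n)) (p : {linear 'rV[R]_n -> M}) :
  presentation A p ->
  presentation (block_mx 1%:M 0 0 A : 'M_(e + m, e + n)) (p \o rsubmx).
Proof.
move=> [Ap p_surj]; split=> [v|x]; last first.
  by have [u <-] := p_surj x; exists (row_mx 0 u); rewrite /= row_mxKr.
rewrite /=; split=> [/Ap[u uA]|[u <-]].
  exists (row_mx (lsubmx v) u).
  by rewrite mul_row_block mulmx1 !mulmx0 addr0 add0r uA hsubmxK.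
rewrite -[u]hsubmxK mul_row_block !mulmx0 add0r row_mxKr.
exact: exact_at_mulmx.
Qed.

(** * Generators of [E] in the coordinates of [G] *)

Section Submodule.
Variables (R : comPzRingType) (e n m : nat) (G : lmodType R).
Variables (E : submodClosed G) (psi : {linear G -> 'rV[R]_e}).
Hypothesis psi_bij : bijective psi.
Variables (A : 'M[R]_(m, n)) (p : {linear 'rV[R]_n -> submod E}).
Hypothesis Ap : presentation A p.

Definition coord_mx : 'M[R]_(n, e) :=
  \matrix_i psi (\val (p (delta_mx 0 i))).

Lemma coord_mxE u : u *m coord_mx = psi (\val (p u)).
Proof.
rewrite mulmx_sum_row -[RHS]/((psi \o \val \o p) u) linear_rV_sum.
by apply: eq_bigr => i _; rewrite rowK.
Qed.

Lemma coord_mx_ker u : u *m coord_mx = 0 <-> p u = 0.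
Proof.
rewrite coord_mxE; split=> [|->]; last by rewrite !linear0.
by rewrite -(linear0 psi) => /(bij_inj psi_bij) pu; apply: val_inj.
Qed.

(** [a] carries each basis vector of [G] into [E], where it is a combination of the generators. *)
Lemma coord_mx_factor a : annihilator (quotmod E) a ->
  exists C : 'M[R]_(e, n), C *m coord_mx = a%:M.
Proof.
move=> aE; have [phi phiK psiK] := psi_bij; have [_ p_surj] := Ap.
have /choice[c cE] (i : 'I_e) : exists u, u *m coord_mx = row i a%:M.
  have aphiE : a *: phi (delta_mx 0 i) \in E.
    rewrite -[_ *: _]subr0; apply/quotmod_eqE.
    by rewrite linearZ linear0; apply: aE.
  have [u pu] := p_surj (Submod aphiE); exists u.
  by rewrite coord_mxE pu /= linearZ /= psiK rowE mul_mx_scalar.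
by exists (\matrix_i c i); apply/row_matrixP => i; rewrite row_mul rowK.
Qed.

Lemma quotmod_presentation :
  exists q : {linear 'rV[R]_e -> quotmod E}, presentation coord_mx q.
Proof.
have [phi phiK psiK] := psi_bij; have [_ p_surj] := Ap.
have phi_linear : linear phi.
  by move=> a u v; apply: (can_inj phiK); rewrite linearP !psiK.
have [q qE] : exists q : {linear 'rV[R]_e -> quotmod E},
    q =1 fun v => quotmod_pi E (phi v).
  by apply: linear_exists => a u v; rewrite phi_linear linearP.
have phiP v : q v = 0 <-> phi v \in E.
  rewrite qE -(linear0 (@quotmod_pi R G E)).
  by split=> [/quotmod_eqE|vE]; [|apply/quotmod_eqE]; rewrite subr0.
exists q; split=> [v|x].
  rewrite phiP; split=> [vE|[u <-]]; last first.
    by rewrite coord_mxE phiK; case: (p u).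
  have [u pu] := p_surj (Submod vE); exists u.
  by rewrite coord_mxE pu /= psiK.
by exists (psi (quotmod_repr x)); rewrite qE phiK quotmod_piK.
Qed.

End Submodule.

(** * Comparison of the two Fitting ideals *)

Theorem proposition2p6 (R : comPzRingType) (e : nat) (G : lmodType R)
    (E : submodClosed G) (F0 Fe : set R) :
  noetherian R ->
  (0 < e)%N ->
  isomorphic G 'rV[R]_e ->
  finitely_generated (submod E) ->
  torsionfree (submod E) ->
  has_rank (submod E) e ->
  fitting_ideal 0 (quotmod E) F0 ->
  fitting_ideal e (submod E) Fe ->
  (exists J : set R, [/\ ideal J, J `<=` Fe & ideal_isom F0 J]) /\
  (ideal_module E e -> proj_dim_eq (submod E) 1 -> F0 = Fe).
Proof.
move=> _ _ [psi psi_bij] _ _ rankE fitF0 fitFe; split.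
  have F0id : ideal F0.
    by have [? [? [? [? [_ ->]]]]] := fitF0; apply: minors_ideal_ideal.
  have [F00 F0D F0M] := F0id.
  have [m [n [A [p [Ap FeE]]]]] := fitFe.
  have [t [Fet regt]] := has_rank_lreg_minor Ap rankE.
  exists [set t * z | z in F0]; split.
  - split=> [|_ _ [x F0x <-] [y F0y <-]|a _ [x F0x <-]].
    + by exists 0; rewrite ?mulr0.
    + by exists (x + y); [exact: F0D|rewrite mulrDr].
    + by exists (a * x); [exact: F0M|rewrite mulrCA].
  - move=> _ [z _ <-]; rewrite FeE mulrC.
    by have [_ _] := minors_ideal_ideal (n - e) A; apply.
  - exists ( *%R t); split=> [x y _ _|a x _|]; [exact: mulrDr|exact: mulrCA|].
    by split=> [x F0x|x y _ _ /regt //|_ [x F0x <-]]; exists x.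
move=> [_ _ /grade_ge2_regular_pair[x [y [annx anny xy]]]] [pd1 _].
have [m [n [A [p [Ap _]]]]] := fitFe.
have [q Bq] := quotmod_presentation psi_bij Ap.
rewrite (fitting_idealE Bq fitF0) subn0.
have A'p' := presentation_pad e Ap; have [A'ex _] := A'p'.
(* The size [e + n - e = n] is complementary to the [e]-minors of [B]. *)
rewrite (fitting_idealE A'p' fitFe) addKn.
have [W [WA kerW]] := proj_dim_le1_split A'p' pd1.
have [Cx CxB] := coord_mx_factor psi_bij Ap annx.
have [Cy CyB] := coord_mx_factor psi_bij Ap anny.
set B := coord_mx psi p in CxB CyB *.
have padB k (X : 'M[R]_(k, e + n)) : X *m col_mx 0 B = rsubmx X *m B.
  by rewrite -[X in LHS]hsubmxK mul_row_col mulmx0 add0r.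
(* What remains: the padded rows are syzygies of the padded [B], and generate them all. *)
symmetry; apply: (minors_ideal_complement xy CxB CyB _ _ WA kerW).
  rewrite padB block_mxEh row_mxKr mul_col_mx mul0mx.
  have -> : A *m B = 0; last by rewrite col_mx0.
  apply/row_matrixP => i; rewrite row_mul row0; apply/(coord_mx_ker psi_bij).
  by rewrite rowE; apply: exact_at_mulmx; case: Ap.
move=> k X; rewrite padB => XB; apply: factor_matrix A'ex _ => u.
rewrite /= -mulmx_rsub; apply/(coord_mx_ker psi_bij).
by rewrite -mulmxA XB mulmx0.
Qed.
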